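(* Let $M=\langle M,+,\cdot\rangle$ be any countable model of Peano arithmetic ${\rm PA}$. Then $M$ has a continuous presentation on the rationals $\mathbb{Q}$: there are binary operations $\oplus,\otimes:\mathbb{Q}\times\mathbb{Q}\to\mathbb{Q}$, continuous with respect to the usual (order) topology on $\mathbb{Q}$ and the product topology on $\mathbb{Q}\times\mathbb{Q}$, such that $\langle \mathbb{Q},\oplus,\otimes\rangle\cong\langle M,+,\cdot\rangle$.
   Context: ${\rm PA}$ is first-order Peano arithmetic in the language $\{+,\cdot\}$ (the non-negative part of a discretely ordered ring together with the full first-order induction scheme). *)

(* Defs.v *)
From HB Require Import structures.
From mathcomp Require Import all_boot all_order all_algebra.
From mathcomp Require Import all_classical topology.

Set Implicit Arguments.
Unset Strict Implicit.
Unset Printing Implicit Defensive.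

(* First-order formulas with equality in the language {+, .}, with de Bruijn
   variables. Satisfaction is taken in a classical metatheory, so falsity,
   implication and universal quantification generate all the connectives. *)
Inductive term : Type :=
  | Var of nat
  | Add of term & term
  | Mul of term & term.

Inductive formula : Type :=
  | Eq of term & term
  | Bot
  | Imp of formula & formula
  | All of formula.

Definition scons (M : Type) (x : M) (e : nat -> M) (i : nat) : M :=
  if i is j.+1 then e j else x.

Section Arithmetic.

Variables (M : Type) (add mul : M -> M -> M).

Fixpoint eval (e : nat -> M) (t : term) : M :=
  match t with
  | Var i => e i
  | Add t u => add (eval e t) (eval e u)
  | Mul t u => mul (eval e t) (eval e u)
  end.

Fixpoint sat (e : nat -> M) (phi : formula) : Prop :=
  match phi with
  | Eq t u => eval e t = eval e u
  | Bot => False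
  | Imp phi psi => sat e phi -> sat e psi
  | All phi => forall x : M, sat (scons x e) phi
  end.

(* The order is not in the signature; it is defined from addition. *)
Definition arith_le (x y : M) : Prop := exists z, add x z = y.
Definition arith_lt (x y : M) : Prop := arith_le x y /\ x <> y.

(* The theory PA^- of the non-negative parts of discretely ordered
   (commutative) rings. Irreflexivity of the order and the existence of
   differences y - x for x <= y are built into the definition of the order. *)
Record PAminus (zero one : M) : Prop := {
  PA_addA : forall x y z, add (add x y) z = add x (add y z);
  PA_addC : forall x y, add x y = add y x;
  PA_mulA : forall x y z, mul (mul x y) z = mul x (mul y z);
  PA_mulC : forall x y, mul x y = mul y x;
  PA_mulDr : forall x y z, mul x (add y z) = add (mul x y) (mul x z);
  PA_add0 : forall x, add x zero = x;
  PA_mul0 : forall x, mul x zero = zero;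
  PA_mul1 : forall x, mul x one = x;
  PA_lt_trans : forall x y z, arith_lt x y -> arith_lt y z -> arith_lt x z;
  PA_lt_total : forall x y, arith_lt x y \/ x = y \/ arith_lt y x;
  PA_lt_add : forall x y z, arith_lt x y -> arith_lt (add x z) (add y z);
  PA_lt_mul : forall x y z,
    arith_lt zero z -> arith_lt x y -> arith_lt (mul x z) (mul y z);
  PA_lt01 : arith_lt zero one;
  PA_discrete : forall x, arith_lt zero x -> arith_le one x;
  PA_nonneg : forall x, arith_le zero x
}.

(* Induction is on variable 0; the environment e supplies the parameters, so
   this is the truth of the universal closures of all induction axioms. *)
Definition induction_scheme (zero one : M) : Prop :=
  forall (phi : formula) (e : nat -> M),
    sat (scons zero e) phi ->
    (forall x, sat (scons x e) phi -> sat (scons (add x one) e) phi) ->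
    forall x, sat (scons x e) phi.

(* The elements 0 and 1 are not in the signature either; the axioms determine
   them uniquely as the neutral elements of + and . *)
Definition PA_model : Prop :=
  exists zero one : M, PAminus zero one /\ induction_scheme zero one.

End Arithmetic.

(* Main.v *)
Require Import Defs.
From HB Require Import structures.
From Stdlib Require Import Ring.
From mathcomp Require Import all_boot all_order all_algebra.
From mathcomp Require Import all_classical topology.

Set Implicit Arguments.
Unset Strict Implicit.
Unset Printing Implicit Defensive.

(** Enumerate [M] as [c_0, c_1, ...] and put [m_k = \prod_(i < k) (c_i + 3)].
    Congruence modulo [m_k] is a decreasing sequence of congruences of the
    semiring [M] with trivial intersection, since [m_(k+1) > c_k], so that
    addition and multiplication are continuous for the topology with the
    congruence classes as basic open sets.  As every class splits into at least
    three classes at the next level, there is a linear order on [M] which is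
    dense without endpoints and whose order topology is this one; by Cantor's
    theorem it is the order of the rationals. *)

Local Open Scope classical_set_scope.

(** * Dense linear orders without endpoints and Cantor's theorem *)

Record dense_order (T : Type) (lt : T -> T -> Prop) : Prop := DenseOrder {
  do_irr : forall x, ~ lt x x;
  do_trans : forall x y z, lt x y -> lt y z -> lt x z;
  do_total : forall x y, [\/ lt x y, x = y | lt y x];
  do_dense : forall x y, lt x y -> exists2 z, lt x z & lt z y;
  do_below : forall x, exists y, lt y x;
  do_above : forall x, exists y, lt x y
}.

Lemma dense_order_flip T (lt : T -> T -> Prop) :
  dense_order lt -> dense_order (fun x y => lt y x).
Proof.
case=> irr trans total dense below above; split => //.
- by move=> x y z yx zy; exact: trans yx.
- by move=> x y; case: (total x y) => ?; [exact: Or33|exact: Or32|exact: Or31].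
- by move=> x y /dense[z yz zx]; exists z.
Qed.

Lemma seq_max (T : eqType) (lt : T -> T -> Prop) (x0 : T) (s : seq T) :
  dense_order lt ->
  exists2 m, m \in x0 :: s & forall x, x \in x0 :: s -> x = m \/ lt x m.
Proof.
move=> doT; elim: s x0 => [|y s IHs] x0.
  by exists x0; rewrite ?mem_head// => x; rewrite inE => /eqP; left.
have [m ms mmax] := IHs y.
have [x0m|x0m|mx0] := do_total doT x0 m.
- exists m; first by rewrite inE ms orbT.
  by move=> x; rewrite inE => /orP[/eqP->|/mmax//]; right.
- exists m; first by rewrite inE ms orbT.
  by move=> x; rewrite inE => /orP[/eqP->|/mmax//]; left.
- exists x0; first by rewrite mem_head.
  move=> x; rewrite inE => /orP[/eqP->|/mmax[->|xm]]; [by left|by right|right].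
  exact: do_trans xm mx0.
Qed.

(** Density applies between the largest element of [L] and the least of [U]. If one list is empty,
    the absence of endpoints gives the bound; if both are, [x0] serves. *)
Lemma dense_order_interpolate (T : eqType) (lt : T -> T -> Prop) (x0 : T)
    (L U : seq T) : dense_order lt ->
  (forall l u, l \in L -> u \in U -> lt l u) ->
  exists2 b, forall l, l \in L -> lt l b & forall u, u \in U -> lt b u.
Proof.
move=> doT; case: L => [|l0 L]; case: U => [|u0 U] LU.
- by exists x0.
- have [m _ mmin] := seq_max u0 U (dense_order_flip doT).
  have [b bm] := do_below doT m; exists b => // u /mmin[->//|].
  exact: do_trans bm.
- have [m _ mmax] := seq_max l0 L doT.
  have [b bm] := do_above doT m; exists b => // u /mmax[->//|um].
  exact: do_trans um bm.
- have [m mL mmax] := seq_max l0 L doT.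
  have [n nU nmin] := seq_max u0 U (dense_order_flip doT).
  have [b mb bn] := do_dense doT (LU _ _ mL nU).
  exists b => [l /mmax[->//|lm]|u /nmin[->//|nu]].
    exact: do_trans lm mb.
  exact: do_trans bn nu.
Qed.

Section Cantor.
Variables (A B : eqType) (ltA : A -> A -> Prop) (ltB : B -> B -> Prop).

(** A finite partial isomorphism as a list of pairs. For linear orders, comparing two pairs both
    ways forces the listed relation to be single-valued and injective. *)
Definition partial_iso (s : seq (A * B)) : Prop :=
  forall p q, p \in s -> q \in s -> (ltA p.1 q.1 <-> ltB p.2 q.2).

Hypotheses (doA : dense_order ltA) (doB : dense_order ltB) (b0 : B).

(** The forth step: a new [a] cuts the finite domain into the points below and above it, and its
    partner interpolates between their images [L] and [U]. Swapping the pairs turns this into the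
    back step. *)
Lemma partial_iso_extend s a : partial_iso s ->
  exists b, partial_iso ((a, b) :: s).
Proof.
move=> iso_s.
(* If [a] is already in the domain, its old partner is reused. *)
have [[p ps <-]|a_s] := pselect (exists2 p, p \in s & p.1 = a).
  exists p.2; rewrite -surjective_pairing => q r.
  by rewrite !inE => /predU1P[->|qs] /predU1P[->|rs]; exact: iso_s.
pose L := [seq p.2 | p <- s & `[< ltA p.1 a >]].
pose U := [seq p.2 | p <- s & `[< ltA a p.1 >]].
have [|b bL bU] := @dense_order_interpolate _ _ b0 L U doB.
  move=> _ _ /mapP[p + ->] /mapP[q + ->].
  rewrite !mem_filter => /andP[/asboolP pa ps] /andP[/asboolP aq qs].
  by apply/iso_s => //; exact: do_trans doA _ _ _ pa aq.
have ltL p : p \in s -> ltA p.1 a -> ltB p.2 b.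
  move=> ps pa; apply: bL; apply/mapP; exists p => //.
  by rewrite mem_filter ps andbT; exact/asboolP.
have ltU p : p \in s -> ltA a p.1 -> ltB b p.2.
  move=> ps pa; apply: bU; apply/mapP; exists p => //.
  by rewrite mem_filter ps andbT; exact/asboolP.
have asymB x y : ltB x y -> ltB y x -> False.
  by move=> xy yx; exact: (do_irr doB) (do_trans doB xy yx).
have cmp p : p \in s -> ltA p.1 a \/ ltA a p.1.
  move=> ps; case: (do_total doA p.1 a) => pa; [by left| |by right].
  by case: a_s; exists p.
exists b => p q; rewrite !inE => /predU1P[->|ps] /predU1P[->|qs] /=.
- by split => [/(do_irr doA)|/(do_irr doB)].
- split=> [|bq]; first exact: ltU.
  by case: (cmp q qs) => // /(ltL q qs) /(asymB _ _ bq).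
- split=> [|bq]; first exact: ltL.
  by case: (cmp p ps) => // /(ltU p ps) /(asymB _ _ bq).
- exact: iso_s.
Qed.

End Cantor.

Lemma partial_iso_swap (A B : eqType) (ltA : A -> A -> Prop)
    (ltB : B -> B -> Prop) (s : seq (A * B)) :
  partial_iso ltA ltB s -> partial_iso ltB ltA [seq (p.2, p.1) | p <- s].
Proof.
move=> iso_s _ _ /mapP[p ps ->] /mapP[q qs ->] /=.
by have [] := iso_s p q ps qs.
Qed.

Theorem cantor_isomorphism (A B : eqType)
    (ltA : A -> A -> Prop) (ltB : B -> B -> Prop)
    (eA : nat -> A) (eB : nat -> B) :
  dense_order ltA -> dense_order ltB ->
  (forall a, exists n, eA n = a) -> (forall b, exists n, eB n = b) ->
  exists2 f : A -> B, bijective f & forall x y, ltA x y <-> ltB (f x) (f y).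
Proof.
move=> doA doB surjA surjB.
(* Stage $n$ adds [eA n] to the domain, then [eB n] to the range by extending the swapped list, so
   the stages exhaust both orders. *)
have step (ns : nat * {s | partial_iso ltA ltB s}) :
    exists t : {s | partial_iso ltA ltB s},
    [/\ {subset sval ns.2 <= sval t}, exists b, (eA ns.1, b) \in sval t
      & exists a, (a, eB ns.1) \in sval t].
  case: ns => n [s iso_s] /=.
  have [b iso_b] := partial_iso_extend doA doB (eB 0) (eA n) iso_s.
  have [a iso_a] :=
    partial_iso_extend doB doA (eA 0) (eB n) (partial_iso_swap iso_b).
  have := partial_iso_swap iso_a.
  rewrite /= -map_comp map_id_in; last by case.
  move=> iso_ab; exists (exist _ _ iso_ab) => /=; split.
  - by move=> p ps; rewrite !inE ps !orbT.
  - by exists b; rewrite !inE eqxx orbT.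
  - by exists a; rewrite mem_head.
have [next nextP] := choice step.
have iso0 : partial_iso ltA ltB [::] by [].
pose S := fix S n := if n is m.+1 then next (m, S m) else exist _ _ iso0.
have subS m n : m <= n -> {subset sval (S m) <= sval (S n)}.
  elim: n => [|n IHn]; first by rewrite leqn0 => /eqP->.
  rewrite leq_eqVlt => /predU1P[->//|/IHn mn] p /mn.
  by have [/(_ p)] := nextP (n, S n).
(* The union of all stages. Any two of its pairs occur together at a later stage, where they can be
   compared. *)
pose G a b := exists n, (a, b) \in sval (S n).
have Glt a a' b b' : G a b -> G a' b' -> (ltA a a' <-> ltB b b').
  move=> [m abm] [n abn].
  exact: (svalP (S (maxn m n))) (subS _ _ (leq_maxl _ _) _ abm)
    (subS _ _ (leq_maxr _ _) _ abn).
have GA a : exists b, G a b.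
  have [n <-] := surjA a.
  by have [_ [b abS] _] := nextP (n, S n); exists b, n.+1.
have GB b : exists a, G a b.
  have [n <-] := surjB b.
  by have [_ _ [a abS]] := nextP (n, S n); exists a, n.+1.
have [f fG] := choice GA; have [g gG] := choice GB.
exists f; last by move=> x y; exact: Glt.
(* Both [g (f a)] and [a] are related to [f a], so by [Glt] neither is below the other; dually for
   [f (g b)]. *)
exists g => [a|b].
- by have [/(Glt _ _ _ _ (gG _) (fG a))/(do_irr doB)| |
    /(Glt _ _ _ _ (fG a) (gG _))/(do_irr doB)] := do_total doA (g (f a)) a.
- by have [/(Glt _ _ _ _ (fG _) (gG b))/(do_irr doA)| |
    /(Glt _ _ _ _ (gG b) (fG _))/(do_irr doA)] := do_total doB (f (g b)) b.
Qed.

Import Order.TTheory GRing.Theory Num.Theory.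

Lemma rat_dense_order : dense_order (fun x y : rat => (x < y)%R).
Proof.
split=> [x|x y z|x y|x y xy|x|x].
- by rewrite ltxx.
- exact: lt_trans.
- by case: (ltgtP x y) => ?; [exact: Or31|exact: Or33|exact: Or32].
- by have [? ?] := midf_lt xy; eexists; eassumption.
- by exists (x - 1)%R; rewrite gtrBl.
- by exists (x + 1)%R; rewrite ltrDl.
Qed.

(** * Separating chains and the ranking of their classes *)

(** What is kept of the congruences modulo $m_k$. Three subclasses are asked for in [chain_split] so
    that the one containing [x] can be placed strictly between two others. *)
Record separating_chain (M : Type) (E : nat -> M -> M -> Prop) : Prop := {
  chain_refl : forall k x, E k x x;
  chain_sym : forall k x y, E k x y -> E k y x;
  chain_trans : forall k x y z, E k x y -> E k y z -> E k x z;
  chain0 : forall x y, E 0 x y;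
  chainS : forall k x y, E k.+1 x y -> E k x y;
  chain_separated : forall x y, (forall k, E k x y) -> x = y;
  chain_split : forall k x, exists y z, [/\ E k x y, E k x z,
    ~ E k.+1 x y, ~ E k.+1 x z & ~ E k.+1 y z]
}.

(** Numbers the classes of [E] so that the class of [x] lies between those of [y] and [z]. The
    injection [g] supplies numbers for the remaining classes. *)
Lemma exists_rank (M : Type) (g : M -> nat) (E : M -> M -> Prop) (x y z : M) :
  injective g ->
  (forall u, E u u) -> (forall u v, E u v -> E v u) ->
  (forall u v w, E u v -> E v w -> E u w) ->
  ~ E x y -> ~ E x z -> ~ E y z ->
  exists r : M -> nat, [/\ forall u v, r u = r v <-> E u v, r y < r x
    & r x < r z].
Proof.
move=> g_inj Er Es Et nxy nxz nyz.
(* A number chosen from the set of codes of the class of [u]. Equivalent elements have the same set,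
   hence the same choice; the set contains [g u], so the default 0 is never the fallback. *)
pose code u := xget 0 [set n | exists2 v, E u v & g v = n].
have codeE u v : code u = code v <-> E u v.
  split=> [|uv].
    have [u' uu' gu'] : exists2 u', E u u' & g u' = code u.
      by apply: (@xgetI _ 0 [set n | exists2 v, E u v & g v = n] (g u)) => /=;
        exists u.
    have [v' vv' gv'] : exists2 v', E v v' & g v' = code v.
      by apply: (@xgetI _ 0 [set n | exists2 u, E v u & g u = n] (g v)) => /=;
        exists v.
    rewrite -gu' -gv' => /g_inj u'v'.
    by apply: Et uu' _; rewrite u'v'; exact: Es.
  rewrite /code; congr xget; apply/seteqP.
  by split => n [w Ew <-]; exists w => //; apply: Et Ew => //; exact: Es.
(* Ranks 0, 1, 2 are reserved for the classes of [y], [x], [z]; the shift by 3 keeps the other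
   classes clear of them. *)
pose r u := if `[< E u y >] then 0 else if `[< E u x >] then 1 else
  if `[< E u z >] then 2 else (code u).+3.
have Etl u v w : E u v -> `[< E u w >] = `[< E v w >].
  by move=> uv; apply: asbool_equiv_eq; split; apply: Et => //; exact: Es.
exists r; split.
- move=> u v; split => [|uv]; last first.
    by rewrite /r !(Etl _ _ _ uv) (iffRL (codeE u v) uv).
  rewrite /r; case: asboolP => [uy|_].
    case: asboolP => [vy _|_]; first by apply: Et uy _; exact: Es.
    by do 2![case: asboolP => // _].
  case: asboolP => [ux|_].
    case: asboolP => // _; case: asboolP => [vx _|_].
      by apply: Et ux _; exact: Es.
    by case: asboolP.
  case: asboolP => [uz|_].
    do 2![case: asboolP => // _]; case: asboolP => // vz _.
    by apply: Et uz _; exact: Es.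
  by do 3![case: asboolP => // _]; case=> /codeE.
- rewrite /r (asboolT (Er y)) (asboolF nxy) (asboolT (Er x)) //.
- rewrite /r (asboolF nxy) (asboolT (Er x)).
  by do 2![rewrite asboolF; last by move=> /Es]; rewrite asboolT.
Qed.

(** * The lexicographic order of a ranked chain *)

Section LexicographicOrder.
Variables (M : Type) (E : nat -> M -> M -> Prop) (r : nat -> M -> nat).
Hypotheses (chE : separating_chain E)
  (rE : forall k x y, r k x = r k y <-> E k.+1 x y).

(* [E k x y] says that the ranks of [x] and [y] agree below [k], so this is the
   lexicographic order on the sequences of ranks. *)
Definition lex_lt x y := exists2 k, E k x y & r k x < r k y.

Lemma chain_le k l x y : k <= l -> E l x y -> E k x y.
Proof.
elim: l => [|l IHl]; first by rewrite leqn0 => /eqP->.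
rewrite leq_eqVlt => /predU1P[->//|kl] /(chainS chE); exact: IHl.
Qed.

Lemma chain_rank k l x y : k < l -> E l x y -> r k x = r k y.
Proof. by move=> kl /(chain_le kl) /rE. Qed.

Lemma lex_lt_irr x : ~ lex_lt x x.
Proof. by case=> k _; rewrite ltnn. Qed.

Lemma lex_lt_trans x y z : lex_lt x y -> lex_lt y z -> lex_lt x z.
Proof.
move=> [k kxy rxy] [l lyz ryz]; case: (ltngtP k l) => kl.
- exists k; first exact: (chain_trans chE kxy (chain_le (ltnW kl) lyz)).
  by rewrite -(chain_rank kl lyz).
- exists l; first exact: (chain_trans chE (chain_le (ltnW kl) kxy) lyz).
  by rewrite (chain_rank kl kxy).
- subst l; exists k; first exact: (chain_trans chE kxy lyz).
  exact: ltn_trans rxy ryz.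
Qed.

Lemma lex_lt_total x y : [\/ lex_lt x y, x = y | lex_lt y x].
Proof.
have [xy|/existsNP[k0 nk0]] := pselect (forall k, E k x y).
  by apply/Or32/(chain_separated chE).
have ex : exists k, ~~ `[< E k x y >] by exists k0; apply/asboolPn.
(* The least level separating [x] and [y] is a successor, because level 0 has a single class. One
   level lower they are still equivalent, and their ranks there differ. *)
case: (ex_minnP ex) => -[|k] /asboolPn nk kmin.
  by case: nk; exact: chain0.
have kxy : E k x y.
  by apply: contrapT => /asboolPn /kmin; rewrite ltnn.
case: (ltngtP (r k x) (r k y)) => rxy.
- by apply: Or31; exists k.
- by apply: Or33; exists k => //; exact: chain_sym.
- by case: nk; apply/rE.
Qed.

(** Classes are convex: if both comparisons were decided at levels below [k], the ranks of [x] and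
    [z] would differ at the smaller of these levels. *)
Lemma lex_lt_convex k x y z : E k x z -> lex_lt x y -> lex_lt y z -> E k x y.
Proof.
move=> kxz [i ixy rxy] [j jyz ryz].
have [ki|ik] := leqP k i; first exact: chain_le ixy.
have [kj|jk] := leqP k j.
  by apply: (chain_trans chE kxz); apply/(chain_sym chE)/(chain_le kj).
case: (ltngtP i j) => ij.
- by move: rxy; rewrite (chain_rank ij jyz) (chain_rank ik kxz) ltnn.
- by move: ryz; rewrite -(chain_rank ij ixy) (chain_rank jk kxz) ltnn.
- by subst j; move: (ltn_trans rxy ryz); rewrite (chain_rank ik kxz) ltnn.
Qed.

Hypothesis lex_unbounded :
  forall k x, exists y z, [/\ E k x y, E k x z, lex_lt y x & lex_lt x z].

Lemma lex_lt_dense_order : dense_order lex_lt.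
Proof.
split; [exact: lex_lt_irr|exact: lex_lt_trans|exact: lex_lt_total| | |].
- move=> x y xy.
  have [k nk] : exists k, ~ E k x y.
    apply/existsNP => /(chain_separated chE) exy.
    by move: xy; rewrite exy; exact: lex_lt_irr.
  (* Take [z] above [x] inside a class of [x] that omits [y]. By convexity [z] cannot reach or pass
     [y]. *)
  have [_ [z [_ kxz _ xz]]] := lex_unbounded k x; exists z => //.
  have [//|zy|yz] := lex_lt_total z y; first by rewrite -zy in nk.
  by case: nk; exact: lex_lt_convex kxz xy yz.
- by move=> x; have [y [_ [_ _ yx _]]] := lex_unbounded 0 x; exists y.
- by move=> x; have [_ [y [_ _ _ xy]]] := lex_unbounded 0 x; exists y.
Qed.

End LexicographicOrder.

(** * Realising a separating chain on the rationals *)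

Lemma countable_enumeration (M : Type) (x0 : M) : countable [set: M] ->
  exists e : nat -> M, forall x, exists n, e n = x.
Proof.
move=> /countable_injP[g g_inj].
have ex_e n : exists y, (exists x, g x = n) -> g y = n.
  have [[x gx]|nex] := pselect (exists x, g x = n); first by exists x.
  by exists x0.
have [e eP] := choice ex_e.
exists e => x; exists (g x); apply: g_inj; rewrite ?inE//.
by apply: eP; exists x.
Qed.

(** The 2-adic valuation takes every value at arbitrarily large arguments: $2^n(2k+1)$ has valuation
    $n$ and is at least $k$. *)
Lemma surj_infinitely_often (M : Type) (e : nat -> M) :
  (forall x, exists n, e n = x) ->
  exists c : nat -> M, forall x k, exists2 l, k <= l & c l = x.
Proof.
move=> e_surj; exists (e \o logn 2) => x k; have [n <-] := e_surj x.
exists (2 ^ n * k.*2.+1).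
  rewrite (leq_trans _ (leq_pmull _ _)) ?expn_gt0//.
  by rewrite -addnn ltnW// ltnS leq_addr.
rewrite /= lognM ?expn_gt0// pfactorK// lognE /=.
by rewrite dvdn2 /= odd_double addn0.
Qed.

(** The last two clauses identify the order topology of the rationals with the topology of the
    classes: every class is a neighbourhood of its points, and every neighbourhood contains a
    class. *)
Theorem separating_chain_rat (M : Type) (E : nat -> M -> M -> Prop) (x0 : M) :
  countable [set: M] -> separating_chain E ->
  exists f : order_topology rat -> M, [/\ bijective f,
    forall k p, \forall q \near p, E k (f p) (f q)
    & forall p N, nbhs p N -> exists k, forall q, E k (f p) (f q) -> N q].
Proof.
move=> M_countable chE; have /countable_injP[g g_inj'] := M_countable.
have g_inj : injective g by move=> x y; apply: g_inj'; rewrite inE.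
have [e e_surj] := countable_enumeration x0 M_countable.
have [c cP] := surj_infinitely_often e_surj.
(* At level [k] the ranks only keep [c k] from being extremal in its class;
   since every [x] is [c k] for arbitrarily large [k], no class has an extremal
   element. *)
have exr k : exists r : M -> nat, (forall u v, r u = r v <-> E k.+1 u v) /\
    exists y z, [/\ E k (c k) y, E k (c k) z, r y < r (c k) & r (c k) < r z].
  have [y [z [ky kz ny nz nyz]]] := chain_split chE k (c k).
  have [r [rE ryx rxz]] := exists_rank g_inj (chain_refl chE k.+1)
    (@chain_sym _ _ chE k.+1) (@chain_trans _ _ chE k.+1) ny nz nyz.
  by exists r; split => //; exists y, z.
have [r rP] := choice exr.
have rE k x y : r k x = r k y <-> E k.+1 x y by case: (rP k).
pose lt := lex_lt E r.
have unb k x : exists y z, [/\ E k x y, E k x z, lt y x & lt x z].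
  have [l kl cx] := cP x k; have [_ [y [z]]] := rP l.
  rewrite cx => -[ly lz ryx rxz]; exists y, z; split.
  - exact: chain_le kl ly.
  - exact: chain_le kl lz.
  - by exists l => //; exact: chain_sym.
  - by exists l.
have doM := lex_lt_dense_order chE rE unb.
(* Open rays are open for the classes: a class of [x] omitting [y] lies, by convexity, on one side
   of [y]. *)
have lt_near x y : lt x y -> exists k, forall z, E k x z -> lt z y.
  move=> xy; have [k nk] : exists k, ~ E k x y.
    apply/existsNP => /(chain_separated chE) exy.
    by move: xy; rewrite exy; exact: lex_lt_irr.
  exists k => z kxz; have [//|zy|yz] := do_total doM z y.
    by rewrite zy in kxz.
  by case: nk; exact: (lex_lt_convex chE rE) kxz xy yz.
have gt_near x y : lt y x -> exists k, forall z, E k x z -> lt y z.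
  move=> yx; have [k nk] : exists k, ~ E k x y.
    apply/existsNP => /(chain_separated chE) exy.
    by move: yx; rewrite exy; exact: lex_lt_irr.
  exists k => z kxz; have [//|zy|zy] := do_total doM y z.
    by rewrite -zy in kxz.
  case: nk; apply: (chain_trans chE kxz).
  exact: (lex_lt_convex chE rE) (chain_sym chE kxz) zy yx.
have erat : forall q : rat, exists n, odflt 0%R (choice.unpickle n) = q.
  by move=> q; exists (choice.pickle q); rewrite choice.pickleK.
(* [{classic M}] equips [M] with the decidable equality that the lists of pairs require. *)
have [f f_bij flt] := @cantor_isomorphism rat {classic M} _ _ _ _
  rat_dense_order doM erat e_surj.
have [h fK hK] := f_bij.
exists f; split => // [k p|p N].
(* As [f p] is not extremal in its class, the class contains points on both sides of it, and by
   convexity everything between them. *)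
- have [y [z [ky kz yp pz]]] := unb k (f p).
  rewrite -[y]hK in ky yp; rewrite -[z]hK in kz pz.
  have op : nbhs (p : order_topology rat) [set` `]h y, h z[%R].
    apply: open_nbhs_nbhs; split.
      exact: (@itv_open _ (order_topology rat)).
    by rewrite /= in_itv /=; apply/andP; split; apply/flt.
  apply: filterS op => q; rewrite /= in_itv /= => /andP[/flt yq /flt qz].
  apply: (chain_trans chE ky).
  apply: (lex_lt_convex chE rE) yq qz.
  exact: (chain_trans chE (chain_sym chE ky) kz).
- rewrite itv_nbhsE => -[[a b] [ab pab] abN].
  move: pab; rewrite /= itv_boundlr => /andP[ap pb].
  (* The endpoints are treated separately: an infinite one already works at level 0, a finite one is
     avoided by a small enough class of [f p]. *)
  have [k kP] : exists k, forall q, E k (f p) (f q) -> (a <= BLeft q)%O.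
    case: a ab ap {abN} => [[] a|[]]//; last by exists 0.
    rewrite bnd_simp => _ /flt/gt_near[k kP].
    by exists k => q /kP/flt; rewrite bnd_simp.
  have [l lP] : exists k, forall q, E k (f p) (f q) -> (BRight q <= b)%O.
    case: b ab pb {abN} => [[] b|[]]//; [|by case: a {kP} ap => [[]|[]]|].
      2: by exists 0.
    rewrite bnd_simp => _ /flt/lt_near[l lP].
    by exists l => q /lP/flt; rewrite bnd_simp.
  exists (maxn k l) => q Eq; apply: abN; rewrite /= itv_boundlr.
  by rewrite kP ?lP//; apply: chain_le Eq => //; rewrite ?leq_maxl ?leq_maxr.
Qed.

(** A neighbourhood of the value contains a class of some level $k$, and the congruence property
    maps the product of the level-$k$ classes of the arguments into that class. *)
Lemma chain_congruence_continuous (M : Type) (E : nat -> M -> M -> Prop)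
    (op : M -> M -> M)
    (f : order_topology rat -> M) (g : M -> order_topology rat) :
  cancel g f ->
  (forall k p, \forall q \near p, E k (f p) (f q)) ->
  (forall p N, nbhs p N -> exists k, forall q, E k (f p) (f q) -> N q) ->
  (forall k x x' y y', E k x x' -> E k y y' -> E k (op x y) (op x' y')) ->
  continuous (fun p : order_topology rat * order_topology rat =>
    g (op (f p.1) (f p.2))).
Proof.
move=> gK f_cts f_open op_cong [p q] N /f_open[k kN].
exists ([set p' | E k (f p) (f p')], [set q' | E k (f q) (f q')]).
  by split; exact: f_cts.
by move=> [p' q'] /= [pp' qq']; apply: kN; rewrite !gK; exact: op_cong.
Qed.

(** * Congruences in a model of arithmetic *)

Section Arithmetic.
Variables (M : Type) (add mul : M -> M -> M) (zero one : M).
Hypothesis PA : PAminus add mul zero one.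

Lemma PA_semi_ring : semi_ring_theory zero one add mul (@eq M).
Proof.
split.
- by move=> x; rewrite (PA_addC PA) (PA_add0 PA).
- exact: PA_addC PA.
- by move=> x y z; rewrite (PA_addA PA).
- by move=> x; rewrite (PA_mulC PA) (PA_mul1 PA).
- by move=> x; rewrite (PA_mulC PA) (PA_mul0 PA).
- exact: PA_mulC PA.
- by move=> x y z; rewrite (PA_mulA PA).
- by move=> x y z; rewrite !(PA_mulC PA _ z) (PA_mulDr PA).
Qed.

Add Ring PA_ring : PA_semi_ring.

Lemma PA_addI x y z : add x y = add x z -> y = z.
Proof.
rewrite !(PA_addC PA x) => xyz.
have [/(PA_lt_add PA x)[_]| [//|/(PA_lt_add PA x)[_]]] := PA_lt_total PA y z.
  by rewrite xyz.
by rewrite xyz.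
Qed.

Lemma PA_pos x : x <> zero -> arith_lt add zero x.
Proof. by move=> x0; split; [exact: PA_nonneg PA x|exact: nesym]. Qed.

Lemma PA_add_eq0 x y : add x y = zero -> x = zero.
Proof.
move=> xy0; apply: contrapT => x0.
have [_] : arith_lt add zero zero; last by [].
by apply: (PA_lt_trans PA (PA_pos x0)); split => //; exists y.
Qed.

(** Multiples of [m] are added on both sides because $M$ has no subtraction. *)
Definition congruent (m x y : M) : Prop :=
  exists u v, add x (mul m u) = add y (mul m v).

Lemma congruent_trans m x y z :
  congruent m x y -> congruent m y z -> congruent m x z.
Proof.
move=> [u [v xy]] [u' [v' yz]]; exists (add u u'), (add v v').
transitivity (add (add x (mul m u)) (mul m u')); first by ring.
rewrite xy; transitivity (add (add y (mul m u')) (mul m v)); first by ring.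
by rewrite yz; ring.
Qed.

Lemma congruent_sym m x y : congruent m x y -> congruent m y x.
Proof. by move=> [u [v xy]]; exists v, u. Qed.

Lemma congruent_add m x x' y y' : congruent m x x' -> congruent m y y' ->
  congruent m (add x y) (add x' y').
Proof.
move=> [u [v xx]] [u' [v' yy]]; exists (add u u'), (add v v').
transitivity (add (add x (mul m u)) (add y (mul m u'))); first by ring.
by rewrite xx yy; ring.
Qed.

Lemma congruent_mulr m x x' y :
  congruent m x x' -> congruent m (mul x y) (mul x' y).
Proof.
move=> [u [v xx]]; exists (mul u y), (mul v y).
transitivity (mul (add x (mul m u)) y); first by ring.
by rewrite xx; ring.
Qed.

Lemma congruent_mul m x x' y y' : congruent m x x' -> congruent m y y' ->
  congruent m (mul x y) (mul x' y').
Proof.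
move=> /(congruent_mulr y) xx /(congruent_mulr x') yy.
by apply: (congruent_trans xx); rewrite !(PA_mulC PA x').
Qed.

Lemma congruent_dvd m t x y : congruent (mul m t) x y -> congruent m x y.
Proof.
by move=> [u [v xy]]; exists (mul t u), (mul t v); rewrite -!(PA_mulA PA).
Qed.

(** Cancelling [x] leaves $mu = d + mv$. If $u \le v$ this forces $d = 0$; otherwise $u = v + w$
    with $w \ge 1$, and $d = mw \ge m$. *)
Lemma congruent_addr m x d :
  congruent m x (add x d) -> d = zero \/ arith_le add m d.
Proof.
move=> [u [v]]; rewrite (PA_addA PA) => /PA_addI uv.
have le_case : arith_le add u v -> d = zero.
  move=> [w uwv]; apply: (@PA_add_eq0 _ (mul m w)).
  by apply: (@PA_addI (mul m u)); rewrite {2}uv -uwv; ring.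
have [[uv' _]|[uv'|[[w vwu] vu]]] := PA_lt_total PA u v.
- by left; exact: le_case.
- by left; apply: le_case; exists zero; rewrite (PA_add0 PA).
right; have [|w' ww'] := PA_discrete PA (x := w).
  by apply: PA_pos => w0; apply: vu; rewrite -vwu w0 (PA_add0 PA).
exists (mul m w'); apply: (@PA_addI (mul m v)).
transitivity (mul m u); first by rewrite -vwu -ww'; ring.
by rewrite uv; ring.
Qed.

Variable c : nat -> M.
Hypothesis c_surj : forall x, exists n, c n = x.

Let two := add one one.
Let three := add one two.

Fixpoint modulus (k : nat) : M :=
  if k is j.+1 then mul (modulus j) (add (c j) three) else one.

Lemma modulus_neq0 k : modulus k <> zero.
Proof.
have one_neq0 : one <> zero by have [_] := PA_lt01 PA; exact: nesym.
elim: k => //= k /PA_pos IHk.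
have t0 : add (c k) three <> zero.
  by rewrite (PA_addC PA) => /PA_add_eq0/PA_add_eq0.
have [_] := PA_lt_mul PA (PA_pos t0) IHk.
by rewrite (PA_mulC PA) (PA_mul0 PA) => /nesym.
Qed.

(** The equation [add d e = two] says $d \le 2$. Hence $m_k d < m_k(c_k + 3) = m_{k+1}$, so a
    nonzero shift by $m_k d$ changes the class modulo $m_{k+1}$. *)
Lemma modulus_split k x d e : add d e = two -> d <> zero ->
  ~ congruent (modulus k.+1) x (add x (mul (modulus k) d)).
Proof.
move=> de d0 /congruent_addr[].
  have [_] := PA_lt_mul PA (PA_pos d0) (PA_pos (@modulus_neq0 k)).
  by rewrite (PA_mulC PA zero) (PA_mul0 PA) => /nesym.
move=> [w mw]; apply: (@modulus_neq0 k).
apply: (@PA_add_eq0 _ (add (mul (modulus k) (add (c k) e)) w)).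
apply: (@PA_addI (mul (modulus k) d)).
rewrite (PA_add0 PA) -{2}mw /= /three -de.
by ring.
Qed.

Lemma congruent_modulus_separated x y :
  (forall k, congruent (modulus k) x y) -> x = y.
Proof.
(* If $v = u + z$ with $z = c_k$ nonzero, congruence modulo $m_{k+1}$ would give $m_k(z + 3) \le z$,
   although $m_k \ge 1$. *)
have sep u v : (forall k, congruent (modulus k) u v) -> ~ arith_lt add u v.
  move=> uv [[z uzv] nuv]; have [k ck] := c_surj z.
  move: (uv k.+1); rewrite -uzv => /congruent_addr[z0|[w]].
    by apply: nuv; rewrite -uzv z0 (PA_add0 PA).
  have [m' m1] := PA_discrete PA (PA_pos (@modulus_neq0 k)).
  rewrite /= ck => zw; apply: (@modulus_neq0 k).
  apply: (@PA_add_eq0 _ (add (add (mul m' z) (mul (modulus k) two)) w)).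
  apply: (@PA_addI z); rewrite (PA_add0 PA) -{3}zw -m1 /three.
  by ring.
move=> xy; have [/(sep _ _ xy)//|[//|/sep]] := PA_lt_total PA x y.
by case=> k; exact: congruent_sym.
Qed.

Lemma congruent_modulus_chain :
  separating_chain (fun k => congruent (modulus k)).
Proof.
split.
- by move=> k x; exists zero, zero.
- by move=> k x y; exact: congruent_sym.
- by move=> k x y z; exact: congruent_trans.
- by move=> x y; exists y, x => /=; ring.
- by move=> k x y; exact: congruent_dvd.
- exact: congruent_modulus_separated.
have one_neq0 : one <> zero by exact: (@modulus_neq0 0).
have two_neq0 : two <> zero by move/PA_add_eq0.
have two0 : add two zero = two by rewrite (PA_add0 PA).
(* The three classes are those of $x$, $x + m_k$ and $x + 2m_k$. The last two again differ by a
   shift by $m_k$. *)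
move=> k x; exists (add x (mul (modulus k) one)), (add x (mul (modulus k) two)).
split.
- by exists one, zero; ring.
- by exists two, zero; ring.
- exact: (@modulus_split k x one one).
- exact: (modulus_split two0).
have -> : add x (mul (modulus k) two) =
    add (add x (mul (modulus k) one)) (mul (modulus k) one).
  by rewrite /two; ring.
exact: (@modulus_split k _ one one).
Qed.

End Arithmetic.

(** * Transporting the operations to the rationals *)

Theorem mainTheorem1 (M : Type) (add mul : M -> M -> M)
    (M_countable : countable [set: M]) (M_PA : PA_model add mul) :
  exists oplus otimes :
      order_topology rat -> order_topology rat -> order_topology rat,
    [/\ continuous (fun p : order_topology rat * order_topology rat =>
          oplus p.1 p.2),
        continuous (fun p : order_topology rat * order_topology rat =>
          otimes p.1 p.2)
      & exists f : order_topology rat -> M,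
          [/\ bijective f,
              {morph f : x y / oplus x y >-> add x y}
            & {morph f : x y / otimes x y >-> mul x y}]].
Proof.
case: M_PA => zero [one [PA _]].
have [c c_surj] := countable_enumeration zero M_countable.
pose E k := congruent add mul (modulus add mul one c k).
have chE : separating_chain E := congruent_modulus_chain PA c_surj.
have [f [f_bij f_cts f_open]] := separating_chain_rat zero M_countable chE.
have [g fK gK] := f_bij.
exists (fun p q => g (add (f p) (f q))), (fun p q => g (mul (f p) (f q))).
split.
- apply: (chain_congruence_continuous gK f_cts f_open) => k x x' y y'.
  exact: (congruent_add PA).
- apply: (chain_congruence_continuous gK f_cts f_open) => k x x' y y'.
  exact: (congruent_mul PA).
- by exists f; split => // p q; rewrite gK.
Qed.
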